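(* Let $\mathscr{F}\subseteq\mathscr{P}(\omega)$ be an $\omega$-closed family and let $(i_1,j_1,F_1)$ and $(i_2,j_2,F_2)$ be nonzero elements of the semigroup $\boldsymbol{B}_{\mathbb{Z}}^{\mathscr{F}}$. Then $(i_1,j_1,F_1)\preccurlyeq(i_2,j_2,F_2)$ if and only if $F_1\subseteq -k+F_2$ and $i_1-i_2=j_1-j_2=k$ for some $k\in\omega$.
   Context: $\omega$ is the set of non-negative integers and $\mathscr{P}(\omega)$ is the family of all its subsets. For $n\in\mathbb{Z}$ and $A\subseteq\mathbb{Z}$ put $n+A=\{n+a: a\in A\}$ (so $n+\varnothing=\varnothing$). A family $\mathscr{F}\subseteq\mathscr{P}(\omega)$ is $\omega$-closed if $F_1\cap(-n+F_2)\in\mathscr{F}$ for all $n\in\omega$ and $F_1,F_2\in\mathscr{F}$. For an $\omega$-closed family $\mathscr{F}$, the set $\mathbb{Z}\times\mathbb{Z}\times\mathscr{F}$ carries the associative operation $$(i_1,j_1,F_1)\cdot(i_2,j_2,F_2)=\begin{cases}(i_1-j_1+i_2,\;j_2,\;(j_1-i_2+F_1)\cap F_2), & j_1<i_2;\\ (i_1,\;j_2,\;F_1\cap F_2), & j_1=i_2;\\ (i_1,\;j_1-i_2+j_2,\;F_1\cap(i_2-j_1+F_2)), & j_1>i_2.\end{cases}$$ If $\varnothing\in\mathscr{F}$, then $\boldsymbol{I}=\{(i,j,\varnothing): i,j\in\mathbb{Z}\}$ is an ideal and $\boldsymbol{B}_{\mathbb{Z}}^{\mathscr{F}}$ is defined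 as the Rees quotient $(\mathbb{Z}\times\mathbb{Z}\times\mathscr{F},\cdot)/\boldsymbol{I}$ ($\boldsymbol{I}$ is collapsed to one element, the zero); if $\varnothing\notin\mathscr{F}$, then $\boldsymbol{B}_{\mathbb{Z}}^{\mathscr{F}}=(\mathbb{Z}\times\mathbb{Z}\times\mathscr{F},\cdot)$. The nonzero elements of $\boldsymbol{B}_{\mathbb{Z}}^{\mathscr{F}}$ are exactly the triples $(i,j,F)$ with $i,j\in\mathbb{Z}$, $F\in\mathscr{F}$, $F\neq\varnothing$. The semigroup $\boldsymbol{B}_{\mathbb{Z}}^{\mathscr{F}}$ is inverse. The natural partial order $\preccurlyeq$ on an inverse semigroup $S$ is: $s\preccurlyeq t$ if and only if $s=te$ for some idempotent $e\in S$. *)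

(* Defs.v *)
From HB Require Import structures.
From mathcomp Require Import all_boot all_order all_algebra.
From mathcomp Require Import boolp classical_sets.
From mathcomp Require Import zify.
Set Implicit Arguments.
Unset Strict Implicit.
Unset Printing Implicit Defensive.
Import Order.TTheory GRing.Theory Num.Theory.
Local Open Scope classical_set_scope.
Local Open Scope quotient_scope.
Local Open Scope ring_scope.

(* Subsets of omega are represented as sets of integers, so that the           *)
(* translates n + A, which may leave omega, need no truncation.                *)

Definition omega : set int := [set z | 0 <= z].

Definition Pomega : set (set int) := [set A | A `<=` omega].

Definition shift (n : int) (A : set int) : set int := [set n + a | a in A].

Lemma shiftE (n : int) (A : set int) (z : int) : shift n A z = A (z - n).
Proof.
apply/propext; split=> [[a Aa <-]|Az]; first by rewrite addrC addKr.
by exists (z - n) => //; rewrite addrC subrK.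
Qed.

Lemma shift0 (A : set int) : shift 0 A = A.
Proof. by apply/funext => z; rewrite shiftE subr0. Qed.

Definition omega_closed (F : set (set int)) : Prop :=
  forall (n : nat) (A B : set int), F A -> F B -> F (A `&` shift (- n%:Z) B).

Definition is_ideal (S : semigroupType) (I : set S) : Prop :=
  forall s x : S, I x -> I (s * x)%g /\ I (x * s)%g.

Section ReesQuotient.
Variables (S : semigroupType) (I : set S).
Hypothesis idealI : is_ideal I.

Definition rees_rel : rel S := fun x y => `[< x = y \/ I x /\ I y >].

Lemma rees_rel_refl : reflexive rees_rel.
Proof. by move=> x; apply/asboolP; left. Qed.

Lemma rees_rel_sym : symmetric rees_rel.
Proof.
by move=> x y; apply/asboolP/asboolP => -[->|[]]; by [left | right].
Qed.

Lemma rees_rel_trans : transitive rees_rel.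
Proof.
move=> y x z /asboolP[->//|[Ix Iy]] /asboolP[<-|[_ Iz]]; apply/asboolP; right.
  by [].
by [].
Qed.

Canonical rees_equiv :=
  EquivRel rees_rel rees_rel_refl rees_rel_sym rees_rel_trans.

(* The ideal property is a parameter of the type because the semigroup         *)
(* structure declared below depends on it.                                     *)
Definition rees_quotient of is_ideal I : Type := {eq_quot rees_equiv}.

Local Notation Q := (rees_quotient idealI).

HB.instance Definition _ := Choice.on Q.
HB.instance Definition _ := Quotient.on Q.

Lemma rees_piP (x y : S) :
  \pi_Q x = \pi_Q y <-> x = y \/ I x /\ I y.
Proof.
split=> [/(@eqmodP _ rees_equiv)/asboolP //|xy].
by apply/(@eqmodP _ rees_equiv)/asboolP.
Qed.

Definition rees_mul (x y : Q) : Q := \pi_Q (repr x * repr y)%g.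

Lemma rees_pi_mul (x y : S) :
  rees_mul (\pi_Q x) (\pi_Q y) = \pi_Q (x * y)%g.
Proof.
rewrite /rees_mul; apply/rees_piP; have /rees_piP Hx := reprK (\pi_Q x).
have /rees_piP Hy := reprK (\pi_Q y).
case: Hx => [->|[Ix' Ix]]; last by right; split; apply: (idealI _ _).2.
case: Hy => [->|[Iy' Iy]]; first by left.
by right; split; apply: (idealI _ _).1.
Qed.

Lemma rees_mulA : associative rees_mul.
Proof.
elim/(@quotW _ Q) => x; elim/(@quotW _ Q) => y; elim/(@quotW _ Q) => z.
by rewrite !rees_pi_mul mulgA.
Qed.

HB.instance Definition _ := isSemigroup.Build Q rees_mulA.

End ReesQuotient.

Section Triples.
Variables (F : set (set int)) (Fcl : omega_closed F).

Definition triple of omega_closed F : Type := int * int * F.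

Local Notation T := (triple Fcl).

HB.instance Definition _ := Choice.on T.

(* The third component of the product, as a set of integers; triple_set_in     *)
(* shows that it belongs to F.                                                 *)
Definition triple_set (j1 i2 : int) (A B : set int) : set int :=
  if j1 < i2 then shift (j1 - i2) A `&` B
  else if j1 == i2 then A `&` B
  else A `&` shift (i2 - j1) B.

Lemma triple_set_in (j1 i2 : int) (A B : F) :
  triple_set j1 i2 (val A) (val B) \in F.
Proof.
have [FA FB] := (set_valP A, set_valP B).
apply/mem_set; rewrite /triple_set; case: ltgtP => [lt12|lt21|_].
- rewrite setIC (_ : j1 - i2 = - `|i2 - j1|%N%:Z); first exact: Fcl.
  lia.
- rewrite (_ : i2 - j1 = - `|j1 - i2|%N%:Z); first exact: Fcl.
  lia.
- by rewrite -[val B]shift0 -oppr0; apply: (Fcl 0).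
Qed.

Definition triple_mul (x y : T) : T :=
  let: (i1, j1, A) := x in
  let: (i2, j2, B) := y in
  let C : F := Sub (triple_set j1 i2 (val A) (val B)) (triple_set_in j1 i2 A B) in
  if j1 < i2 then (i1 - j1 + i2, j2, C)
  else if j1 == i2 then (i1, j2, C)
  else (i1, j1 - i2 + j2, C).

Lemma triple_setE (j1 i2 : int) (A B : set int) (z : int) :
  triple_set j1 i2 A B z =
  (A (z + Num.max 0 (i2 - j1)) /\ B (z + Num.max 0 (j1 - i2))).
Proof.
rewrite /triple_set; case: ltgtP => h; rewrite /setI /= ?shiftE;
  by congr (A _ /\ B _); lia.
Qed.

Lemma triple_mulE (i1 j1 i2 j2 : int) (A B : F) :
  triple_mul (i1, j1, A) (i2, j2, B) =
  (i1 + Num.max 0 (i2 - j1), j2 + Num.max 0 (j1 - i2),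
   Sub (triple_set j1 i2 (val A) (val B)) (triple_set_in j1 i2 A B)).
Proof.
by rewrite /triple_mul; case: ltgtP => h; congr (_, _, _); lia.
Qed.

Lemma triple_mulA : associative triple_mul.
Proof.
move=> [[i1 j1] A] [[i2 j2] B] [[i3 j3] C]; rewrite !triple_mulE.
congr (_, _, _); [lia | lia | apply/val_inj/funext => z].
rewrite !SubK !triple_setE [RHS](propext (and_assoc _ _ _)).
by congr (val A _ /\ val B _ /\ val C _); lia.
Qed.

HB.instance Definition _ := isSemigroup.Build T triple_mulA.

Definition empty_triples : set T := [set x | val x.2 = set0].

Lemma empty_triples_ideal : is_ideal empty_triples.
Proof.
move=> [[i1 j1] A] [[i2 j2] B] B0.
have vE z : ~ val B z by rewrite [val B]B0.
have mulE (x y : T) : (x * y)%g = triple_mul x y by [].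
split; rewrite /empty_triples /mkset mulE triple_mulE; apply/seteqP;
  split=> // z; rewrite SubK triple_setE => -[].
  by move=> _ /vE.
by move=> /vE.
Qed.

(* When the empty set is not in F nothing is collapsed.                        *)
Definition BZ_of (c : {F set0} + {~ F set0}) : semigroupType :=
  if c then (rees_quotient empty_triples_ideal : semigroupType)
  else (T : semigroupType).

Definition BZ_elt_of (c : {F set0} + {~ F set0}) (x : T) : BZ_of c :=
  match c as c' return BZ_of c' with
  | left _ => \pi_(rees_quotient empty_triples_ideal) x
  | right _ => x
  end.

Definition BZ : semigroupType := BZ_of (pselect (F set0)).

(* The element of BZ denoted by a triple; it is the zero of BZ exactly when A  *)
(* is empty.                                                                   *)
Definition BZ_elt (i j : int) (A : F) : BZ :=
  BZ_elt_of (pselect (F set0)) (i, j, A).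

End Triples.

Definition is_idempotent (S : semigroupType) (e : S) : Prop := (e * e)%g = e.

(* This formula is the natural partial order when S is an inverse semigroup.   *)
Definition natural_le (S : semigroupType) (s t : S) : Prop :=
  exists2 e : S, is_idempotent e & s = (t * e)%g.

(* Main.v *)
Require Import Defs.
From mathcomp Require Import all_boot all_order all_algebra.
From mathcomp Require Import boolp classical_sets.
From mathcomp Require Import zify.
Import Order.TTheory GRing.Theory Num.Theory.
Local Open Scope classical_set_scope.
Local Open Scope ring_scope.

(** Idempotent triples lie on the diagonal: they have the form (a, a, G). Multiplying (i2, j2, F2)
    on the right by one adds k = max(0, a - j2) to i2, and meets -k + F2 with a translate of G; when
    the product is (i1, j1, F1), j1 - j2 is the same k. Conversely, (j1, j1, F1) is an idempotent
    that cuts (i2, j2, F2) down to (i1, j1, F1). [natural_le_triple] carries this computation, and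
    [natural_le_rees_pi] shows that collapsing the empty triples does not affect the order below a
    nonzero element. *)

Lemma natural_le_rees_pi (S : semigroupType) (I : set S) (idealI : is_ideal I)
    (s t : S) :
  ~ I s ->
  @natural_le (rees_quotient idealI)
    (\pi_(rees_quotient idealI)%qT s) (\pi_(rees_quotient idealI)%qT t) <->
  natural_le s t.
Proof.
pose Q := rees_quotient idealI.
have mulE (x y : S) : (\pi_Q%qT x * \pi_Q%qT y)%g = \pi_Q%qT (x * y)%g.
  exact: rees_pi_mul.
move=> nIs; split=> -[].
  elim/(@quotW _ Q) => e.
  rewrite /is_idempotent !mulE => /rees_piP ee /rees_piP[ste|[//]].
  (* The class of [s] is a singleton, so [s = t * e] already holds in [S]. If [e * e] and [e] were
     merely identified, [e] would lie in [I], and hence so would [s]. *)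
  exists e => //; case: ee => [//|[_ Ie]].
  by case: nIs; rewrite ste; apply: (idealI t e Ie).1.
move=> e ee ->; exists (\pi_Q%qT e); last by rewrite mulE.
by rewrite /is_idempotent mulE ee.
Qed.

Lemma natural_le_triple (F : set (set int)) (Fcl : omega_closed F)
    (i1 j1 i2 j2 : int) (F1 F2 : F) :
  @natural_le (triple Fcl) (i1, j1, F1) (i2, j2, F2) <->
  exists k : nat, [/\ \val F1 `<=` shift (- k%:Z) (\val F2),
                      i1 - i2 = k%:Z & j1 - j2 = k%:Z].
Proof.
have mulE (x y : triple Fcl) : (x * y)%g = triple_mul x y by [].
split=> [[[[a b] G]]|[k [F12 Ei Ej]]].
  rewrite /is_idempotent !mulE !triple_mulE => -[Ea Eb _] [Ei Ej EF].
  (* Idempotency gives max(0, a - b) = 0 and max(0, b - a) = 0. *)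
  have ab : a = b by lia.
  exists (absz (Num.max 0 (a - j2))); split; [|lia|lia].
  move=> z; rewrite EF SubK triple_setE shiftE => -[F2z _].
  by rewrite (_ : z - _ = z + Num.max 0 (a - j2)) //; lia.
(* With s = (i1, j1, F1), this witness is the idempotent s^-1 s, the canonical choice in an inverse
   semigroup. *)
exists (j1, j1, F1); rewrite /is_idempotent mulE triple_mulE.
  congr (_, _, _); [lia|lia|apply/val_inj/funext => z].
  rewrite SubK triple_setE subrr maxxx addr0; apply/propext; tauto.
congr (_, _, _); [lia|lia|apply/val_inj/funext => z].
rewrite SubK triple_setE (_ : Num.max 0 (j1 - j2) = k%:Z); last by lia.
rewrite (_ : Num.max 0 (j2 - j1) = 0); last by lia.
rewrite addr0; apply/propext; split=> [F1z|[]//]; split=> //.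
by have := F12 z F1z; rewrite shiftE opprK.
Qed.

Theorem mainTheorem4 (F : set (set int)) (Fomega : F `<=` Pomega)
    (Fcl : omega_closed F) (i1 j1 i2 j2 : int) (F1 F2 : F)
    (F1_neq0 : \val F1 <> set0) (F2_neq0 : \val F2 <> set0) :
  natural_le (BZ_elt Fcl i1 j1 F1) (BZ_elt Fcl i2 j2 F2) <->
  exists k : nat, [/\ \val F1 `<=` shift (- k%:Z) (\val F2),
                      i1 - i2 = k%:Z & j1 - j2 = k%:Z].
Proof.
apply: (iff_trans _ (natural_le_triple _ Fcl i1 j1 i2 j2 F1 F2)).
(* If the empty set is not in [F], [BZ] is the semigroup of triples itself; otherwise [F1_neq0]
   keeps the left-hand triple out of the ideal. *)
rewrite /BZ_elt /BZ; case: (pselect (F set0)) => [F0|nF0] //.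
exact: natural_le_rees_pi.
Qed.
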